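(* If $\{(X_i,R_i,f_i):i\in\mathbb N\}$ is a surjective inverse system of tournaments with inverse limit tournament $(X,R)$, then $(X,R)$ is arc cyclic if and only if $(X_i,R_i)$ is arc cyclic for every $i\in\mathbb N$.
   Context: A tournament on a nonempty set $X$ is a relation $R\subset X\times X$ with $R\cap R^{-1}=1_X$ (the diagonal) and $R\cup R^{-1}=X\times X$; $R^\circ=R\setminus1_X$. It is arc cyclic if for every arc $(x_1,x_2)\in R^\circ$ there is $x_3\in X$ with $(x_2,x_3),(x_3,x_1)\in R^\circ$. A surjective inverse system of tournaments $\{(X_i,R_i,f_i)\}$ consists of tournaments $(X_i,R_i)$, $i\in\mathbb N$, and surjective functions $f_i:X_{i+1}\to X_i$ with $(f_i\times f_i)(R_{i+1})\subset R_i$. Its inverse limit is the tournament $(X,R)$ with $X=\{x\in\prod_iX_i:f_i(x_{i+1})=x_i\text{ for all }i\}$ and $R=\{(x,x')\in X\times X:(x_i,x_i')\in R_i\text{ for all }i\}$. *)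

(* Defs.v *)
From Stdlib Require Import Relations FinFun Arith Lia Classical ClassicalEpsilon
  FunctionalExtensionality ProofIrrelevance.

(** The two equations [R ∩ R⁻¹ = 1_X] and [R ∪ R⁻¹ = X × X], read pointwise;
    the carrier is not assumed finite. *)
Record tournament : Type := Tournament {
  carrier :> Type;
  rel : relation carrier;
  tournament_nonempty : inhabited carrier;
  rel_cap_inverse : forall x y, rel x y /\ rel y x <-> x = y;
  rel_cup_inverse : forall x y, rel x y \/ rel y x
}.

Arguments rel {t} _ _.

(** [arc] is [R°], that is [R] minus the diagonal. *)
Definition arc {X : tournament} (x y : X) : Prop := rel x y /\ x <> y.

Definition arc_cyclic (X : tournament) : Prop :=
  forall x1 x2 : X, arc x1 x2 -> exists x3 : X, arc x2 x3 /\ arc x3 x1.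

Record surjective_inverse_system (X : nat -> tournament)
    (f : forall i, X (S i) -> X i) : Prop := {
  bonding_surjective : forall i, Surjective (f i);
  bonding_rel : forall i (x y : X (S i)), rel x y -> rel (f i x) (f i y)
}.

Section InverseLimit.

Context (X : nat -> tournament) (f : forall i, X (S i) -> X i).

Definition thread : Type :=
  {x : forall i, X i | forall i, f i (x (S i)) = x i}.

Definition coord (x : thread) (i : nat) : X i := proj1_sig x i.

Definition thread_rel (x y : thread) : Prop :=
  forall i, rel (coord x i) (coord y i).

Lemma coordE (x : thread) i : f i (coord x (S i)) = coord x i.
Proof. exact (proj2_sig x i). Qed.

Lemma thread_ext (x y : thread) : (forall i, coord x i = coord y i) -> x = y.
Proof.
intros H; destruct x as [x hx], y as [y hy].
apply subset_eq_compat, functional_extensionality_dep; exact H.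
Qed.

Lemma thread_rel_cap_inverse x y :
  thread_rel x y /\ thread_rel y x <-> x = y.
Proof.
split.
- intros [Hxy Hyx]; apply thread_ext; intros i.
  apply rel_cap_inverse; split; [apply Hxy | apply Hyx].
- intros <-; split; intros i; now apply (rel_cap_inverse (X i)).
Qed.

Context (Xf : surjective_inverse_system X f).

Lemma thread_inhabited : inhabited thread.
Proof.
destruct (tournament_nonempty (X 0)) as [x0].
pose (g i y := proj1_sig (constructive_indefinite_description _
                            (bonding_surjective _ _ Xf i y))).
constructor.
exists (nat_rect (fun i => X i) x0 g).
intros i; simpl; unfold g at 1.
apply (proj2_sig (constructive_indefinite_description (fun x => f i x = _) _)).
Qed.

Lemma rel_coord_le x y i j :
  i <= j -> rel (coord x j) (coord y j) -> rel (coord x i) (coord y i).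
Proof.
induction 1 as [|j _ IH]; intros H; [exact H|].
apply IH; rewrite <- (coordE x j), <- (coordE y j).
now apply (bonding_rel _ _ Xf).
Qed.

Lemma thread_rel_cup_inverse x y : thread_rel x y \/ thread_rel y x.
Proof.
destruct (classic (thread_rel x y)) as [H|H]; [now left | right].
apply not_all_ex_not in H; destruct H as [i Hi].
intros j.
apply (rel_coord_le y x j (Nat.max i j)); [lia|].
destruct (rel_cup_inverse _ (coord x (Nat.max i j)) (coord y (Nat.max i j)))
  as [H|H]; [|exact H].
exfalso; apply Hi, (rel_coord_le x y i (Nat.max i j)); [lia | exact H].
Qed.

Definition inverse_limit : tournament :=
  Tournament thread thread_rel thread_inhabited
    thread_rel_cap_inverse thread_rel_cup_inverse.

End InverseLimit.

(* Main.v *)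
Require Import Defs.
From Stdlib Require Import Classical ClassicalEpsilon.

(** A tournament has exactly one arc between two distinct points, so an arc
    between the images of two points under a relation-preserving map comes from
    an arc between the points themselves ([rel_hom_reflects_arc]).  The
    projections of the inverse limit preserve the relation, and they are
    surjective because the bonding maps are ([coord_surjective]).

    Both implications follow by moving one cycle through a single projection.
    Given an arc in [X i], lift its endpoints to threads; they form an arc of
    the limit, which lies on a 3-cycle, and the projection of that cycle to
    [X i] cannot collapse because two of its vertices stay distinct.
    Conversely, an arc of the limit is already an arc in some coordinate [i];
    close it to a 3-cycle in [X i] and lift the third vertex to any thread:
    reflection of arcs puts that thread on a 3-cycle in the limit. *)

Lemma rel_antisym (X : tournament) (x y : X) : rel x y -> rel y x -> x = y.
Proof. intros Hxy Hyx; apply rel_cap_inverse; now split. Qed.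

(** If [x] and [y] were not related in this order they would be in the other,
    and the images would then be related both ways, hence equal. *)
Lemma rel_hom_reflects_arc (X Y : tournament) (p : X -> Y)
    (Hp : forall x y, rel x y -> rel (p x) (p y)) (x y : X) :
  arc (p x) (p y) -> arc x y.
Proof.
intros [Hxy Hne]; split; [|now intros ->].
destruct (rel_cup_inverse X x y) as [H|H]; [exact H|].
destruct Hne; apply rel_antisym; [exact Hxy | now apply Hp].
Qed.

(** Choosing preimages step by step lifts a point of [X 0].  For a later index,
    the induction passes to the system without its first term: a thread of that
    shifted system extends to index [0] by applying [f 0]. This avoids
    transporting points along equations between indices. *)
Lemma coord_surjective (X : nat -> tournament) (f : forall i, X (S i) -> X i)
    (hf : surjective_inverse_system X f) (i : nat) (a : X i) :
  exists x : thread X f, coord X f x i = a.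
Proof.
revert X f hf a; induction i as [|i IH]; intros X f hf a.
- pose (g i y := proj1_sig (constructive_indefinite_description _
                              (bonding_surjective _ _ hf i y))).
  assert (Hg : forall j, f j (nat_rect (fun i => X i) a g (S j))
                         = nat_rect (fun i => X i) a g j).
  { intros j; exact (proj2_sig (constructive_indefinite_description _
                       (bonding_surjective _ _ hf j _))). }
  now exists (exist _ _ Hg).
- assert (hf' : surjective_inverse_system (fun n => X (S n)) (fun n => f (S n))).
  { split; intros n; [apply (bonding_surjective _ _ hf) | apply (bonding_rel _ _ hf)]. }
  destruct (IH _ _ hf' a) as [[x Hx] Hxi].
  pose (x' n := match n return X n with 0 => f 0 (x 0) | S n => x n end).
  assert (Hx' : forall n, f n (x' (S n)) = x' n).
  { intros [|n]; [reflexivity | exact (Hx n)]. }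
  now exists (exist _ x' Hx').
Qed.

Lemma arc_of_coord (X : nat -> tournament) (f : forall i, X (S i) -> X i)
    (hf : surjective_inverse_system X f) (i : nat) (x y : inverse_limit X f hf) :
  arc (coord X f x i) (coord X f y i) -> arc x y.
Proof.
apply (rel_hom_reflects_arc (inverse_limit X f hf) (X i) (fun z => coord X f z i)).
intros u v H; exact (H i).
Qed.

Lemma arc_coord_exists (X : nat -> tournament) (f : forall i, X (S i) -> X i)
    (hf : surjective_inverse_system X f) (x y : inverse_limit X f hf) :
  arc x y -> exists i, arc (coord X f x i) (coord X f y i).
Proof.
intros [Hxy Hne].
destruct (not_all_ex_not _ (fun i => coord X f x i = coord X f y i)) as [i Hi].
- intros H; apply Hne, thread_ext, H.
- exists i; split; [exact (Hxy i) | exact Hi].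
Qed.

Theorem proposition4p3 (X : nat -> tournament) (f : forall i : nat, X (S i) -> X i)
    (hf : surjective_inverse_system X f) :
  arc_cyclic (inverse_limit X f hf) <-> (forall i : nat, arc_cyclic (X i)).
Proof.
split.
- intros Hlim i a b Hab.
  destruct (coord_surjective X f hf i a) as [x <-].
  destruct (coord_surjective X f hf i b) as [y <-].
  destruct (Hlim x y (arc_of_coord X f hf i x y Hab)) as [z [[Hyz _] [Hzx _]]].
  destruct Hab as [Hxy Hne].
  specialize (Hyz i); specialize (Hzx i).
  (* If z met x or y in coordinate i, the arc there would be reversed too. *)
  exists (coord X f z i); repeat split; trivial; intros E; apply Hne;
    apply rel_antisym; trivial.
  + now rewrite E.
  + now rewrite <- E.
- intros Hall x y Hxy.
  destruct (arc_coord_exists X f hf x y Hxy) as [i Hi].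
  destruct (Hall i _ _ Hi) as [c [Hyc Hcx]].
  destruct (coord_surjective X f hf i c) as [z <-].
  exists z; split; now apply (arc_of_coord X f hf i).
Qed.
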